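(* Let $G$ be a finite connected simple graph on $[d]$ and suppose $\mathcal{H}$ is a separating hyperplane of the edge polytope $\mathcal{P}_G$, giving the decomposition $\mathcal{P}_G=\mathcal{P}_{G_+}\cup\mathcal{P}_{G_-}$ with $\mathcal{P}_{G_+}=\mathcal{P}_G\cap\mathcal{H}^{(+)}$ and $\mathcal{P}_{G_-}=\mathcal{P}_G\cap\mathcal{H}^{(-)}$. If both $G_+$ and $G_-$ are quadratic, then $G$ is quadratic.
   Context: For an edge $e=(i,j)$ of a graph on $[d]$, put $\rho(e)=\mathbf{e}_i+\mathbf{e}_j\in\mathbb{R}^d$ ($\mathbf{e}_i$ the unit coordinate vectors). The edge polytope $\mathcal{P}_G$ is the convex hull of $\{\rho(e):e\in E(G)\}$. For a hyperplane $\mathcal{H}$, $\mathcal{H}^{(+)},\mathcal{H}^{(-)}$ are the two closed half-spaces with intersection $\mathcal{H}$. A separating hyperplane of a polytope $P$ is a hyperplane meeting the relative interior of $P$ (and not containing $P$) such that $P\cap\mathcal{H}^{(+)}$ and $P\cap\mathcal{H}^{(-)}$ are both integral polytopes (vertices in $\mathbb{Z}^d$). $G_+$ (resp. $G_-$) is the spanning subgraph of $G$ on $[d]$ with edge set $\{e\in E(G):\rho(e)\in\mathcal{H}^{(+)}\}$ (resp. $\{e:\rho(e)\in\mathcal{H}^{(-)}\}$); then $\mathcal{P}_G\cap\mathcal{H}^{(\pm)}=\mathcal{P}_{G_\pm}$. For a graph $H$ on $[d]$ with edges $e_1,\dots,e_n$ and a field $K$, let $\pi:K[x_1,\dots,x_n]\to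 K[t_1,\dots,t_d]$ be the $K$-algebra map with $\pi(x_k)=t_it_j$ where $e_k=(i,j)$; its kernel $I_H$ is the toric ideal of $H$. The graph $H$ (or $\mathcal{P}_H$) is called quadratic if $I_H$ is generated by quadratic binomials. *)

(* Defs.v *)
From HB Require Import structures.
From mathcomp Require Import all_boot all_order all_algebra.
From mathcomp Require Import mpoly.
From mathcomp Require Import classical_sets reals topology.

Set Implicit Arguments.
Unset Strict Implicit.
Unset Printing Implicit Defensive.

Import Order.TTheory GRing.Theory Num.Theory.
Import numFieldTopology.Exports.
Local Open Scope classical_set_scope.
Local Open Scope ring_scope.

Record sgraph (d : nat) := SGraph {
  adj :> rel 'I_d;
  adj_sym : ssrbool.symmetric adj;
  adj_irr : irreflexive adj }.

Definition connected_graph (d : nat) (G : sgraph d) : Prop :=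
  forall i j : 'I_d, connect G i j.

(* The edge {i, j} is represented by the pair (i, j) with i < j. *)
Definition edges (d : nat) (G : sgraph d) : {set 'I_d * 'I_d} :=
  [set p : 'I_d * 'I_d | (p.1 < p.2)%N && G p.1 p.2]%SET.

Definition dotv (R : realType) (d : nat) (a x : 'rV[R]_d) : R :=
  \sum_(i < d) a 0 i * x 0 i.

Definition convex_hull (R : realType) (d : nat) (A : set 'rV[R]_d) :
    set 'rV[R]_d :=
  [set x | exists (n : nat) (p : 'I_n -> 'rV[R]_d) (w : 'I_n -> R),
     [/\ forall i, A (p i), forall i, 0 <= w i, \sum_(i < n) w i = 1
       & x = \sum_(i < n) w i *: p i]].

Definition affine_hull (R : realType) (d : nat) (A : set 'rV[R]_d) :
    set 'rV[R]_d :=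
  [set x | exists (n : nat) (p : 'I_n -> 'rV[R]_d) (w : 'I_n -> R),
     [/\ forall i, A (p i), \sum_(i < n) w i = 1
       & x = \sum_(i < n) w i *: p i]].

(* Interior of P with respect to the topology induced on its affine hull. *)
Definition relative_interior (R : realType) (d : nat) (P : set 'rV[R]_d) :
    set 'rV[R]_d :=
  [set x | P x /\ within (affine_hull P) (nbhs x) P].

Definition is_polytope (R : realType) (d : nat) (P : set 'rV[R]_d) : Prop :=
  exists s : seq 'rV[R]_d, P = convex_hull [set x | x \in s].

(* Vertices are taken as extreme points. *)
Definition is_vertex (R : realType) (d : nat) (P : set 'rV[R]_d)
    (v : 'rV[R]_d) : Prop :=
  P v /\ forall (x y : 'rV[R]_d) (t : R), P x -> P y -> 0 < t < 1 ->
    v = t *: x + (1 - t) *: y -> x = v /\ y = v.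

Definition integral_polytope (R : realType) (d : nat) (P : set 'rV[R]_d) :
    Prop :=
  is_polytope P /\
  forall v, is_vertex P v -> forall i : 'I_d, v 0 i \is a Num.int.

Definition edge_vec (R : realType) (d : nat) (i j : 'I_d) : 'rV[R]_d :=
  delta_mx 0 i + delta_mx 0 j.

Definition edge_polytope (R : realType) (d : nat) (G : sgraph d) :
    set 'rV[R]_d :=
  convex_hull [set x | exists2 p, p \in edges G & x = edge_vec R p.1 p.2].

Arguments edge_polytope R {d} G.

Definition hyperplane (R : realType) (d : nat) (a : 'rV[R]_d) (b : R) :
    set 'rV[R]_d :=
  [set x | dotv a x = b].

Definition halfspace_pos (R : realType) (d : nat) (a : 'rV[R]_d) (b : R) :
    set 'rV[R]_d :=
  [set x | b <= dotv a x].

Definition halfspace_neg (R : realType) (d : nat) (a : 'rV[R]_d) (b : R) :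
    set 'rV[R]_d :=
  [set x | dotv a x <= b].

Definition separating_hyperplane (R : realType) (d : nat) (P : set 'rV[R]_d)
    (a : 'rV[R]_d) (b : R) : Prop :=
  [/\ a != 0,
      hyperplane a b `&` relative_interior P !=set0,
      ~ (P `<=` hyperplane a b),
      integral_polytope (P `&` halfspace_pos a b)
    & integral_polytope (P `&` halfspace_neg a b)].

Section HalfGraphs.
Variables (R : realType) (d : nat) (G : sgraph d) (a : 'rV[R]_d) (b : R).

Definition adj_pos : rel 'I_d :=
  fun i j => G i j && (b <= dotv a (edge_vec R i j)).

Definition adj_neg : rel 'I_d :=
  fun i j => G i j && (dotv a (edge_vec R i j) <= b).

Lemma adj_pos_sym : ssrbool.symmetric adj_pos.
Proof. by move=> i j; rewrite /adj_pos adj_sym /edge_vec addrC. Qed.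

Lemma adj_pos_irr : irreflexive adj_pos.
Proof. by move=> i; rewrite /adj_pos adj_irr. Qed.

Lemma adj_neg_sym : ssrbool.symmetric adj_neg.
Proof. by move=> i j; rewrite /adj_neg adj_sym /edge_vec addrC. Qed.

Lemma adj_neg_irr : irreflexive adj_neg.
Proof. by move=> i; rewrite /adj_neg adj_irr. Qed.

Definition graph_pos : sgraph d := SGraph adj_pos_sym adj_pos_irr.
Definition graph_neg : sgraph d := SGraph adj_neg_sym adj_neg_irr.

End HalfGraphs.

(* The variable 'X_k of K[x_1, ..., x_n] is attached to the k-th edge. *)
Definition toric_map (K : fieldType) (d : nat) (H : sgraph d)
    (f : {mpoly K[#|edges H|]}) : {mpoly K[d]} :=
  mmap (@mpolyC d K)
       (fun k : 'I_#|edges H| =>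
          'X_(enum_val k).1 * 'X_(enum_val k).2 : {mpoly K[d]}) f.

Definition toric_ideal (K : fieldType) (d : nat) (H : sgraph d) :
    set {mpoly K[#|edges H|]} :=
  [set f | toric_map f = 0].

Arguments toric_ideal K {d} H.

Definition ideal_gen (A : comNzRingType) (B : set A) : set A :=
  [set f | exists (n : nat) (c g : 'I_n -> A),
     (forall i, B (g i)) /\ f = \sum_(i < n) c i * g i].

Definition quadratic_binomial (K : fieldType) (n : nat) (f : {mpoly K[n]}) :
    Prop :=
  exists u v : 'X_{1..n},
    [/\ mdeg u = 2%N, mdeg v = 2%N, u != v & f = 'X_[u] - 'X_[v]].

(* B may be empty: H is quadratic when its toric ideal is zero. *)
Definition quadratic_graph (K : fieldType) (d : nat) (H : sgraph d) : Prop :=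
  exists B : set {mpoly K[#|edges H|]},
    (forall f, B f -> quadratic_binomial f) /\
    toric_ideal K H = ideal_gen B.

(* Main.v *)
(**
Write l(e) = a.rho(e) - b. If l(e) > 0 > l(f), then [rho(e), rho(f)] is not an
edge of the polytope, for otherwise its point on the hyperplane would be a
non-integral vertex of the positive half. Exhibiting supporting functionals,
this forces e and f to be disjoint and opposite in a 4-cycle of G. Each of the two
other edges g, h of that cycle meets both e and f, hence lies on neither strict
side: l(g) = l(h) = 0, while rho(e) + rho(f) = rho(g) + rho(h).

Thus, modulo quadratic binomials of the toric ideal, every monomial is congruent
to one supported on a single side of the hyperplane. Two monomials with the same
toric image have the same total level, so their one-sided representatives can be
chosen on the same side, where the hypothesis on G+ or G- applies. *)

From HB Require Import structures.
Require Import Defs.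
From mathcomp Require Import all_boot all_order all_algebra reals.
From mathcomp Require Import mpoly classical_sets ring lra.

Set Implicit Arguments.
Unset Strict Implicit.
Unset Printing Implicit Defensive.

Import Order.TTheory GRing.Theory Num.Theory.
Local Open Scope ring_scope.

(** * Convex geometry of the edge polytope, and edges on opposite sides of the hyperplane *)

Section SeparatingHyperplane.
Variables (R : realType) (d : nat).
Implicit Types (G : sgraph d) (a c x y : 'rV[R]_d).

Definition level a (b : R) (p : 'I_d * 'I_d) : R := a 0 p.1 + a 0 p.2 - b.

Lemma dotvD c x y : dotv c (x + y) = dotv c x + dotv c y.
Proof.
by rewrite /dotv -big_split; apply: eq_bigr => i _; rewrite mxE mulrDr.
Qed.

Lemma dotvZ c k x : dotv c (k *: x) = k * dotv c x.
Proof.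
by rewrite /dotv mulr_sumr; apply: eq_bigr => i _; rewrite mxE mulrCA.
Qed.

Lemma dotv_sum c (I : Type) (r : seq I) (P : pred I) (F : I -> 'rV[R]_d) :
  dotv c (\sum_(i <- r | P i) F i) = \sum_(i <- r | P i) dotv c (F i).
Proof.
apply: (big_morph (dotv c) (dotvD c)).
by rewrite /dotv big1 // => i _; rewrite mxE mulr0.
Qed.

Lemma dotv_edge_vec c (i j : 'I_d) : dotv c (edge_vec R i j) = c 0 i + c 0 j.
Proof.
have dE k : dotv c (delta_mx 0 k) = c 0 k.
  rewrite /dotv (bigD1 k) //= big1 ?addr0 => [|l nkl].
    by rewrite mxE !eqxx mulr1.
  by rewrite mxE (negbTE nkl) andbF mulr0.
by rewrite dotvD !dE.
Qed.

Lemma edge_vecC (i j : 'I_d) : edge_vec R i j = edge_vec R j i.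
Proof. by rewrite /edge_vec addrC. Qed.

Lemma edge_vec_in_polytope G i j : G i j -> edge_polytope R G (edge_vec R i j).
Proof.
move=> Gij; exists 1%N, (fun=> edge_vec R i j), (fun=> 1).
split=> // [_||]; last 2 first.
- by rewrite big_ord1.
- by rewrite big_ord1 scale1r.
have nij : i != j by apply: contraTneq Gij => ->; rewrite adj_irr.
have [ltij|] := ltnP i j; first by exists (i, j); rewrite // inE /= ltij.
rewrite leq_eqVlt (inj_eq val_inj) eq_sym (negbTE nij) /= => ltji.
by exists (j, i); rewrite ?inE /= ?ltji ?[G j i]adj_sym // edge_vecC.
Qed.

Lemma convex_hull_convex (A : set 'rV[R]_d) x y (s : R) :
  0 <= s <= 1 -> convex_hull A x -> convex_hull A y ->
  convex_hull A (s *: x + (1 - s) *: y).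
Proof.
move=> /andP[s0 s1] [n [p [w [Ap w0 w1 ->]]]] [m [q [z [Aq z0 z1 ->]]]].
exists (n + m)%N,
  (fun i => match split i with inl i => p i | inr i => q i end),
  (fun i => match split i with inl i => s * w i | inr i => (1 - s) * z i end).
split=> [i|i||].
- by case: split.
- by case: split => k; rewrite mulr_ge0 // subr_ge0.
- rewrite big_split_ord /=.
  under eq_bigr do rewrite (unsplitK (inl _)).
  under [X in _ + X]eq_bigr do rewrite (unsplitK (inr _)).
  by rewrite -!mulr_sumr w1 z1 !mulr1 subrKC.
- rewrite big_split_ord /= !scaler_sumr; congr (_ + _).
    by apply: eq_bigr => i _; rewrite (unsplitK (inl _)) scalerA.
  by apply: eq_bigr => i _; rewrite (unsplitK (inr _)) scalerA.
Qed.

(* The functional c exhibits [u, v] as a face of the convex hull of A. *)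
Lemma convex_hull_segment_face (A : set 'rV[R]_d) c (u v : 'rV[R]_d) x :
  (forall z, A z -> dotv c z <= 0) ->
  (forall z, A z -> dotv c z = 0 -> z = u \/ z = v) ->
  convex_hull A x -> dotv c x = 0 ->
  exists s : R, x = s *: u + (1 - s) *: v.
Proof.
move=> cA0 cAuv [n [p [w [Ap w0 w1 ->]]]].
rewrite dotv_sum => sum0.
have wc0 i : w i * dotv c (p i) = 0.
  apply/eqP; rewrite -oppr_eq0; apply/eqP.
  have/psumr_eq0P H : forall j, true -> 0 <= - (w j * dotv c (p j)).
    by move=> j _; rewrite -mulrN mulr_ge0 ?w0 // oppr_ge0 cA0.
  apply: H => //; rewrite sumrN.
  by under eq_bigr do rewrite -dotvZ; rewrite sum0 oppr0.
(* The coefficient is the total weight carried by points equal to [u]; any other point of nonzero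
   weight lies on the face, hence is [v]. *)
exists (\sum_(i | p i == u) w i).
have -> : 1 - \sum_(i | p i == u) w i = \sum_(i | p i != u) w i.
  by rewrite -w1 (bigID (fun i => p i == u)) /= addrC addrK.
rewrite !scaler_suml (bigID (fun i => p i == u)) /=; congr (_ + _).
  by apply: eq_bigr => i /eqP ->.
apply: eq_bigr => i /eqP piu.
have /eqP := wc0 i; rewrite mulf_eq0 => /orP[/eqP->|/eqP].
  by rewrite !scale0r.
by case/(cAuv _ (Ap i)) => // ->.
Qed.

Variables (G : sgraph d) (a : 'rV[R]_d) (b : R).
Hypothesis int_pos :
  integral_polytope (edge_polytope R G `&` halfspace_pos a b)%classic.

Local Notation lev i j := (level a b (i, j)).

(* The crossing point of a face [rho(ij), rho(kl)] of the polytope with the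
   hyperplane would be a non-integral vertex of the positive half. *)
Lemma crossing_face_absurd c (i j k l : 'I_d) :
  G i j -> G k l -> i != j -> i != k -> i != l ->
  (forall p q, G p q -> c 0 p + c 0 q <= 0) ->
  (forall p q, G p q -> c 0 p + c 0 q = 0 ->
     edge_vec R p q = edge_vec R i j \/ edge_vec R p q = edge_vec R k l) ->
  c 0 i + c 0 j = 0 -> c 0 k + c 0 l = 0 ->
  lev i j * lev k l < 0 -> False.
Proof.
move=> Gij Gkl nij nik nil c0 c0eq cij ckl.
(* [s] solves [s * lev i j + (1 - s) * lev k l = 0]: it is the parameter at which the segment meets
   the hyperplane. *)
pose D := lev i j - lev k l; pose s := - lev k l / D => opp.
have D0 : D != 0 by apply/eqP => D0; move: opp; rewrite /D in D0; nra.
have sD : s * D = - lev k l by rewrite mulfVK.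
have s01 : 0 < s < 1.
  (* The sign of [D] is unknown, so the bounds on [s] are checked after multiplying by [D * D]. *)
  have DD : 0 < D * D by rewrite lt0r mulf_neq0 //= -expr2 sqr_ge0.
  have sDD : s * (D * D) = - lev k l * D by rewrite mulrA sD.
  by apply/andP; split; rewrite -(ltr_pM2r DD) sDD ?mul0r ?mul1r /D; nra.
pose v := s *: edge_vec R i j + (1 - s) *: edge_vec R k l.
have av (t : R) : dotv a (t *: edge_vec R i j + (1 - t) *: edge_vec R k l) - b
    = (t - s) * D.
  rewrite mulrBl sD dotvD !dotvZ !dotv_edge_vec /D /level /=; ring.
have cv : dotv c v = 0.
  by rewrite dotvD !dotvZ !dotv_edge_vec cij ckl !mulr0 addr0.
have Pv : edge_polytope R G v.
  have /andP[s0 s1] := s01.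
  by apply: convex_hull_convex; rewrite ?(ltW s0) ?(ltW s1) //;
     apply: edge_vec_in_polytope.
have hv : dotv a v = b by apply/eqP; rewrite -subr_eq0 av subrr mul0r.
have adjE p : p \in edges G -> G p.1 p.2 by rewrite inE => /andP[].
have cle x : edge_polytope R G x -> dotv c x <= 0.
  case=> n [p [w [Ap w0 w1 ->]]]; rewrite dotv_sum.
  apply: sumr_le0 => m _; rewrite dotvZ mulr_ge0_le0 //.
  by have [q /adjE Gq ->] := Ap m; rewrite dotv_edge_vec c0.
have face x : edge_polytope R G x -> dotv c x = 0 -> dotv a x = b -> x = v.
  move=> Px cx ax.
  have [||t xE] := convex_hull_segment_face (u := edge_vec R i j)
      (v := edge_vec R k l) (c := c) _ _ Px cx.
  - by move=> z [q /adjE Gq ->]; rewrite dotv_edge_vec c0.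
  - by move=> z [q /adjE Gq ->]; rewrite dotv_edge_vec; apply: c0eq.
  have := av t; rewrite -xE ax subrr => /esym/eqP.
  rewrite mulf_eq0 (negbTE D0) orbF subr_eq0 => /eqP ts.
  by rewrite xE ts.
(* [v] attains equality in both [dotv c <= 0] and [b <= dotv a], so both ends of a segment through
   it do too, and [face] identifies them with [v]. *)
have vtx : is_vertex (edge_polytope R G `&` halfspace_pos a b)%classic v.
  split; first by split=> //; rewrite /halfspace_pos /= hv.
  move=> x y t [Px hx] [Py hy] /andP[t0 t1] vE.
  have t1' : 0 < 1 - t by rewrite subr_gt0.
  rewrite /halfspace_pos /= in hx hy.
  have cx := cle _ Px; have cy := cle _ Py.
  move: cv hv; rewrite vE !dotvD !dotvZ => cv' av'.
  have cx0 : dotv c x = 0 by nra.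
  have cy0 : dotv c y = 0 by nra.
  have ax0 : dotv a x = b by nra.
  have ay0 : dotv a y = b by nra.
  by split; [rewrite -vE; apply: face|rewrite -vE; apply: face].
have := int_pos.2 v vtx i.
(* As [i] differs from [j], [k] and [l], this coordinate sees only the first endpoint and equals
   [s], which lies strictly between 0 and 1. *)
have -> : v 0 i = s.
  rewrite !mxE !eqxx /= (negbTE nij) (negbTE nik) (negbTE nil) /=; ring.
case/intrP => z zE; have := s01.
by rewrite zE ltr0z ltrz1 gtz0_ge1 leNgt andNb.
Qed.

(** Two distinct edges with a common vertex span a face of the polytope, so [crossing_face_absurd]
    applies; if [i = k], the product of levels is a square. *)
Lemma crossing_edges_disjoint i j k :
  G i j -> G j k -> lev i j * lev j k < 0 -> False.
Proof.
move=> Gij Gjk opp.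
have nij : i != j by apply: contraTneq Gij => ->; rewrite adj_irr.
have njk : j != k by apply: contraTneq Gjk => ->; rewrite adj_irr.
have nik : i != k.
  apply: contraTneq opp => ->.
  by rewrite /level /= [a 0 k + _]addrC -expr2 -leNgt sqr_ge0.
(* An edge through [j] has value 0 if its other end is [i] or [k], and -2 otherwise; an edge
   avoiding [j] has value at most -2. *)
pose c : 'rV[R]_d := \row_p (if p == j then 1 else
  if (p == i) || (p == k) then -1 else - 3).
apply: (@crossing_face_absurd c i j j k) opp => //.
- move=> p q Gpq; rewrite !mxE {c}.
  have npq : p != q by apply: contraTneq Gpq => ->; rewrite adj_irr.
  have [pj|_] := eqVneq p j; have [qj|_] := eqVneq q j;
  [by rewrite pj qj eqxx in npq|..];
  by repeat case: ifP => _; lra.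
- move=> p q Gpq; rewrite !mxE {c}.
  have npq : p != q by apply: contraTneq Gpq => ->; rewrite adj_irr.
  have [->|_] := eqVneq p j.
    have [->|_] := eqVneq q j; first by move=> ?; exfalso; lra.
    have [->|_] := eqVneq q i; first by left; rewrite edge_vecC.
    have [->|_] /= := eqVneq q k; first by right.
    by move=> ?; exfalso; lra.
  have [->|_] := eqVneq q j.
    have [->|_] := eqVneq p i; first by left.
    have [->|_] /= := eqVneq p k; first by right; rewrite edge_vecC.
    by move=> ?; exfalso; lra.
  by repeat case: ifP => _; move=> ?; exfalso; lra.
- by rewrite !mxE !eqxx (negbTE nij) /= addrC subrr.
- by rewrite !mxE !eqxx eq_sym (negbTE njk) orbT subrr.
Qed.

(* Without jk and jl, all edges of G joining ij to kl meet i, so that rho(ij)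
   and rho(kl) span a face of the polytope. *)
Lemma crossing_edges_joined i j k l :
  G i j -> G k l -> ~~ G j k -> ~~ G j l ->
  i != k -> i != l -> j != k -> j != l ->
  lev i j * lev k l < 0 -> False.
Proof.
move=> Gij Gkl nGjk nGjl nik nil njk njl opp.
have nij : i != j by apply: contraTneq Gij => ->; rewrite adj_irr.
have nkl : k != l by apply: contraTneq Gkl => ->; rewrite adj_irr.
(* Among pairs of distinct vertices, only [jk] and [jl] get a positive value, and they are not
   edges; only [ij] and [kl] get 0. *)
pose c : 'rV[R]_d := \row_p (if p == j then 1 else if p == i then -1 else
  if (p == k) || (p == l) then 0 else - 3).
have cneg p q : G p q -> c 0 p + c 0 q = 0 /\ (edge_vec R p q = edge_vec R i j
    \/ edge_vec R p q = edge_vec R k l) \/ c 0 p + c 0 q < 0.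
  move=> Gpq; rewrite !mxE {c}.
  have npq : p != q by apply: contraTneq Gpq => ->; rewrite adj_irr.
  have [pj|_] := eqVneq p j.
    have [qj|_] := eqVneq q j; first by rewrite pj qj eqxx in npq.
    have [->|_] := eqVneq q i.
      by left; split; [lra|left; rewrite pj edge_vecC].
    have [qk|_] := eqVneq q k; first by rewrite pj qk (negbTE nGjk) in Gpq.
    have [ql|_] := eqVneq q l; first by rewrite pj ql (negbTE nGjl) in Gpq.
    by right => /=; lra.
  have [qj|_] := eqVneq q j.
    have [->|_] := eqVneq p i; first by left; split; [lra|left; rewrite qj].
    have [pk|_] := eqVneq p k.
      by rewrite qj pk adj_sym (negbTE nGjk) in Gpq.
    have [pl|_] := eqVneq p l.
      by rewrite qj pl adj_sym (negbTE nGjl) in Gpq.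
    by right => /=; lra.
  have [pi|_] := eqVneq p i; first by right; repeat case: ifP => _; lra.
  have [qi|_] := eqVneq q i; first by right; repeat case: ifP => _; lra.
  have [pk|_] := eqVneq p k; have [ql|_] /= := eqVneq q l.
  - by left; rewrite orbT; split; [lra|right; rewrite pk ql].
  - have [qk|_] := eqVneq q k; first by rewrite pk qk eqxx in npq.
    by right => /=; lra.
  - have [pl|_] := eqVneq p l; first by rewrite pl ql eqxx in npq.
    by right; rewrite orbT; lra.
  have [pl|_] := eqVneq p l; have [qk|_] /= := eqVneq q k; last by right; lra.
  - by left; split; [lra|right; rewrite pl qk edge_vecC].
  - by right; lra.
  - by right; lra.
apply: (@crossing_face_absurd c i j k l) opp => //.
- by move=> p q /cneg[[-> _]|/ltW].
- by move=> p q /cneg[[_ ?]|cpq cpq0] //; rewrite cpq0 ltxx in cpq.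
- by rewrite !mxE !eqxx (negbTE nij) addrC subrr.
- rewrite !mxE !eqxx orbT /= ![_ == j]eq_sym (negbTE njk) (negbTE njl).
  by rewrite ![_ == i]eq_sym (negbTE nik) (negbTE nil) addr0.
Qed.

(** A shared vertex is excluded by [crossing_edges_disjoint]. By [crossing_edges_joined], used for
    each vertex in turn, all four vertices have a neighbour on the other edge; a bipartite graph on
    2 + 2 vertices without isolated vertices has a perfect matching. *)
Lemma crossing_edges_swap i j k l :
  G i j -> G k l -> lev i j * lev k l < 0 ->
  (G i k && G j l) || (G i l && G j k).
Proof.
move=> Gij Gkl opp.
have Gji : G j i by rewrite adj_sym.
have Glk : G l k by rewrite adj_sym.
have levC p q : lev p q = lev q p by rewrite /level /= [a 0 p + _]addrC.
have nik : i != k.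
  by apply/eqP => ik; apply: (crossing_edges_disjoint Gji (k := l));
    rewrite ?ik // levC -{1}ik.
have nil : i != l.
  by apply/eqP => il; apply: (crossing_edges_disjoint Gji (k := k));
    rewrite ?il // levC -{1}il (levC l).
have njk : j != k.
  by apply/eqP => jk; apply: (crossing_edges_disjoint Gij (k := l));
    rewrite jk // -{1}jk.
have njl : j != l.
  by apply/eqP => jl; apply: (crossing_edges_disjoint Gij (k := k));
    rewrite jl // -{1}jl (levC l).
have joined p q r t : G p q -> G r t -> p != r -> p != t -> q != r ->
    q != t -> lev p q * lev r t < 0 -> G q r || G q t.
  move=> ? ? ? ? ? ? ?; rewrite -[_ || _]negbK negb_or.
  apply/negP => /andP[? ?].
  by apply: (@crossing_edges_joined p q r t).
have := joined i j k l Gij Gkl nik nil njk njl opp.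
have := joined j i k l Gji Gkl njk njl nik nil; rewrite levC => /(_ opp).
have := joined k l i j Gkl Gij; rewrite mulrC ![k == _]eq_sym ![l == _]eq_sym.
move=> /(_ nik njk nil njl opp).
have := joined l k i j Glk Gij; rewrite mulrC (levC l) ![k == _]eq_sym.
rewrite ![l == _]eq_sym => /(_ nil njl nik njk opp).
rewrite ![G l _]adj_sym ![G k _]adj_sym.
by case: (G i k); case: (G j l); case: (G i l); case: (G j k).
Qed.

(* Each of the two new edges meets both ij and kl, so it can lie strictly on
   neither side of the hyperplane. *)
Lemma crossing_edges_exchange i j k l :
  G i j -> G k l -> lev i j * lev k l < 0 ->
  exists k' l', [/\ (k', l') = (k, l) \/ (k', l') = (l, k), G i k', G j l',
                   lev i k' = 0 & lev j l' = 0].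
Proof.
have levC p q : lev p q = lev q p by rewrite /level /= [a 0 p + _]addrC.
(* On a path [pqrt], both products with [lev q r] are nonnegative by [crossing_edges_disjoint]; if
   [lev q r] were nonzero, multiplying them would make [lev p q * lev r t] nonnegative. *)
have flat p q r t : G p q -> G q r -> G r t -> lev p q * lev r t < 0 ->
    lev q r = 0.
  move=> Gpq Gqr Grt opp; apply/eqP/negPn/negP => nz.
  have /negP := crossing_edges_disjoint Gpq Gqr.
  have /negP := crossing_edges_disjoint Gqr Grt.
  rewrite -!leNgt => h1 h2.
  have sq : 0 < lev q r * lev q r by rewrite lt0r mulf_neq0 //= -expr2 sqr_ge0.
  have := mulr_ge0 h1 h2; have -> : lev q r * lev r t * (lev p q * lev q r)
      = lev q r * lev q r * (lev p q * lev r t) by ring.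
  by rewrite pmulr_rge0 // leNgt opp.
move=> Gij Gkl opp.
have Gji : G j i by rewrite adj_sym.
have Glk : G l k by rewrite adj_sym.
case/orP: (crossing_edges_swap Gij Gkl opp) => /andP[G1 G2].
  exists k, l; split=> //; first by left.
    by apply: (flat j i k l) => //; rewrite levC.
  by apply: (flat i j l k) => //; rewrite (levC l).
exists l, k; split=> //; first by right.
  by apply: (flat j i l k) => //; rewrite levC (levC l).
by apply: (flat i j k l).
Qed.

End SeparatingHyperplane.

(** * Ideals generated by a set, and congruence modulo them *)

Section IdealGen.
Variables (A : comNzRingType) (B : set A).
Implicit Types f g : A.

Lemma ideal_gen0 : ideal_gen B 0.
Proof.
by exists 0%N, (fun=> 0), (fun=> 0); split=> [[]|] //; rewrite big_ord0.
Qed.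

Lemma ideal_gen_sub f : B f -> ideal_gen B f.
Proof.
by move=> Bf; exists 1%N, (fun=> 1), (fun=> f); rewrite big_ord1 mul1r.
Qed.

Lemma ideal_genM f g : ideal_gen B g -> ideal_gen B (f * g).
Proof.
case=> n [c [h [Bh ->]]]; exists n, (fun i => f * c i), h; split=> //.
by rewrite mulr_sumr; apply: eq_bigr => i _; rewrite mulrA.
Qed.

Lemma ideal_genD f g : ideal_gen B f -> ideal_gen B g -> ideal_gen B (f + g).
Proof.
case=> n [c [h [Bh ->]]] [m [c' [h' [Bh' ->]]]].
exists (n + m)%N,
  (fun i => match split i with inl i => c i | inr i => c' i end),
  (fun i => match split i with inl i => h i | inr i => h' i end).
split=> [i|]; first by case: split.
rewrite big_split_ord; congr (_ + _); apply: eq_bigr => i _.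
  by rewrite (unsplitK (inl _)).
by rewrite (unsplitK (inr _)).
Qed.

Lemma ideal_genN f : ideal_gen B f -> ideal_gen B (- f).
Proof. by rewrite -mulN1r; apply: ideal_genM. Qed.

Lemma ideal_gen_sum (I : eqType) (r : seq I) (F : I -> A) :
  (forall i, i \in r -> ideal_gen B (F i)) -> ideal_gen B (\sum_(i <- r) F i).
Proof.
move=> BF; rewrite big_seq; apply: (big_ind (ideal_gen B)) => //.
- exact: ideal_gen0.
- exact: ideal_genD.
Qed.

(** Here [ideal_gen B (f - g)] is read as congruence of [f] and [g] modulo the ideal. *)
Lemma ideal_gen_trans f g h :
  ideal_gen B (f - g) -> ideal_gen B (g - h) -> ideal_gen B (f - h).
Proof. 
move=> fg gh; have -> : f - h = (f - g) + (g - h) by ring.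
exact: ideal_genD.
 Qed.

Lemma ideal_gen_distC f g : ideal_gen B (f - g) -> ideal_gen B (g - f).
Proof. by move=> /ideal_genN; rewrite opprB. Qed.

End IdealGen.

(** * Toric ideals through lists of edges *)

Section ToricIdeal.
Variables (K : fieldType) (d : nat).
Implicit Types (G H : sgraph d) (p : 'I_d * 'I_d) (s t : seq ('I_d * 'I_d)).

HB.instance Definition _ H := GRing.RMorphism.copy (@toric_map K d H)
  (mmap (@mpolyC d K) (fun k : 'I_#|edges H| =>
     'X_(enum_val k).1 * 'X_(enum_val k).2 : {mpoly K[d]})).

Definition edge_mnm p : 'X_{1..d} := (U_(p.1) + U_(p.2))%MM.

(** Monomials in the edge variables are handled as lists of edges with repetition, so that one list
    makes sense for [G] and for its subgraphs alike; this is the exponent of the toric image. *)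
Definition edges_mnm s : 'X_{1..d} := (\sum_(p <- s) edge_mnm p)%MM.

Definition mnm_edges H (u : 'X_{1..#|edges H|}) : seq ('I_d * 'I_d) :=
  flatten [seq nseq (u k) (enum_val k) | k <- enum 'I_#|edges H|].

(* Either orientation of an edge gives its variable; the empty product 1 is a
   junk value for pairs that are not edges. *)
Definition edge_var H p : {mpoly K[#|edges H|]} :=
  \prod_(k < #|edges H| | (enum_val k == p) || (enum_val k == (p.2, p.1))) 'X_k.

Definition edges_mon H s : {mpoly K[#|edges H|]} := \prod_(p <- s) edge_var H p.

Definition edges_of H : pred ('I_d * 'I_d) := fun p => H p.1 p.2.

Lemma enum_val_edges_of H (k : 'I_#|edges H|) : edges_of H (enum_val k).
Proof. by have := enum_valP k; rewrite inE => /andP[]. Qed.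

(** The reversed pair is never enumerated, since [edges] keeps only increasing pairs. *)
Lemma edge_varE H (k : 'I_#|edges H|) : edge_var H (enum_val k) = 'X_k.
Proof.
rewrite /edge_var (big_pred1 k) // => l /=; rewrite (inj_eq enum_val_inj).
case: eqP => //= _; apply/negP => /eqP lk.
have := enum_valP l; have := enum_valP k; rewrite lk !inE /=.
by case/andP => lt1 _ /andP[lt2 _]; have := ltn_trans lt1 lt2; rewrite ltnn.
Qed.

Lemma edge_varC H i j : edge_var H (i, j) = edge_var H (j, i).
Proof. by apply: eq_bigl => k; rewrite orbC. Qed.

Lemma edges_ofP H p : edges_of H p ->
  exists k : 'I_#|edges H|, enum_val k = p \/ enum_val k = (p.2, p.1).
Proof.
case: p => i j; rewrite /edges_of /= => Hij.
have nij : i != j by apply: contraTneq Hij => ->; rewrite adj_irr.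
have [ltij|] := ltnP i j.
  have He : (i, j) \in edges H by rewrite inE /= ltij.
  by exists (enum_rank_in He (i, j)); left; rewrite enum_rankK_in.
rewrite leq_eqVlt (inj_eq val_inj) eq_sym (negbTE nij) /= => ltji.
have He : (j, i) \in edges H by rewrite inE /= ltji [H j i]adj_sym.
by exists (enum_rank_in He (j, i)); right; rewrite enum_rankK_in.
Qed.

Lemma edge_var_edge H p : edges_of H p -> exists2 k : 'I_#|edges H|,
  edge_var H p = 'X_k & enum_val k = p \/ enum_val k = (p.2, p.1).
Proof.
move=> /edges_ofP[k kE]; exists k => //; rewrite -edge_varE.
by case: kE => -> //; case: p => i j; rewrite edge_varC.
Qed.

Lemma toric_mapX H (k : 'I_#|edges H|) :
  toric_map ('X_k : {mpoly K[_]}) = 'X_[edge_mnm (enum_val k)].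
Proof. by rewrite /toric_map mmapX mmap1U mpolyXD. Qed.

Lemma toric_map_edge_var H p :
  edges_of H p -> toric_map (edge_var H p) = 'X_[edge_mnm p].
Proof.
move=> /edge_var_edge[k ->]; rewrite toric_mapX => -[] -> //.
by rewrite /edge_mnm addmC.
Qed.

Lemma toric_map_edges_mon H s :
  all (edges_of H) s -> toric_map (edges_mon H s) = 'X_[edges_mnm s].
Proof.
move=> /allP sH; rewrite /edges_mon rmorph_prod /edges_mnm.
rewrite (big_morph _ (@mpolyXD _ _) (@mpolyX0 _ _)).
by apply: eq_big_seq => p /sH; apply: toric_map_edge_var.
Qed.

Lemma edges_mon_cons H p s :
  edges_mon H (p :: s) = edge_var H p * edges_mon H s.
Proof. by rewrite /edges_mon big_cons. Qed.

Lemma mnm_edges_all H u : all (edges_of H) (mnm_edges (H := H) u).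
Proof.
apply/allP => _ /flattenP[_ /mapP[k _ ->] /nseqP[-> _]].
exact: enum_val_edges_of.
Qed.

Lemma edges_mon_mnm_edges H u : edges_mon H (mnm_edges u) = 'X_[u].
Proof.
rewrite /edges_mon /mnm_edges big_flatten big_map mpolyXE_id big_enum /=.
by apply: eq_bigr => k _; rewrite big_nseq edge_varE iter_mulr_1.
Qed.

Lemma size_mnm_edges H u : size (mnm_edges (H := H) u) = mdeg u.
Proof.
rewrite /mnm_edges size_flatten /shape -map_comp sumnE big_map mdegE big_enum.
by apply: eq_bigr => k _; rewrite /= size_nseq.
Qed.

Lemma mpolyX_inj n : injective (fun m : 'X_{1..n} => 'X_[K, m]).
Proof.
move=> m1 m2 /(congr1 (mcoeff m2)); rewrite !mcoeffX eqxx.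
by case: eqP => // _ /eqP; rewrite eq_sym oner_eq0.
Qed.

(** The generating set is the largest possible: it contains every [B] that witnesses
    [quadratic_graph]. *)
Definition quadric_ideal H : set {mpoly K[#|edges H|]} :=
  ideal_gen [set f | quadratic_binomial f /\ toric_ideal K H f]%classic.

Lemma quadric_ideal_toric H (f : {mpoly K[#|edges H|]}) :
  quadric_ideal f -> toric_ideal K H f.
Proof.
case=> n [c [g [gq ->]]]; rewrite /toric_ideal /= rmorph_sum big1 // => i _.
by have [_] := gq i; rewrite rmorphM /= /toric_ideal /= => ->; rewrite mulr0.
Qed.

Lemma quadric_exchange H p1 p2 q1 q2 :
  all (edges_of H) [:: p1; p2; q1; q2] ->
  edges_mnm [:: p1; p2] = edges_mnm [:: q1; q2] ->
  quadric_ideal (edges_mon H [:: p1; p2] - edges_mon H [:: q1; q2]).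
Proof.
move=> /and5P[Hp1 Hp2 Hq1 Hq2 _] pq.
have ker : toric_ideal K H (edges_mon H [:: p1; p2] - edges_mon H [:: q1; q2]).
  by rewrite /toric_ideal /= rmorphB /= !toric_map_edges_mon /= ?pq ?subrr
    ?Hp1 ?Hp2 ?Hq1 ?Hq2.
have mon2 r1 r2 : edges_of H r1 -> edges_of H r2 ->
    exists2 u : 'X_{1..#|edges H|}, mdeg u = 2%N &
      edges_mon H [:: r1; r2] = 'X_[u].
  move=> /edge_var_edge[k kE _] /edge_var_edge[l lE _].
  exists (U_(k) + U_(l))%MM; first by rewrite mdegD !mdeg1.
  by rewrite !edges_mon_cons kE lE mpolyXD /edges_mon big_nil mulr1.
have [u u2 uE] := mon2 _ _ Hp1 Hp2; have [v v2 vE] := mon2 _ _ Hq1 Hq2.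
(* [quadratic_binomial] demands distinct monomials, so a zero difference is treated apart. *)
have [uv|nuv] := eqVneq u v.
  by rewrite uE vE uv subrr; apply: ideal_gen0.
by apply: ideal_gen_sub; split=> //; exists u, v; rewrite uE vE.
Qed.

(* A polynomial in the kernel is congruent to the sum of its monomials moved to
   one chosen representative in each fibre, and that sum vanishes. *)
Lemma toric_ideal_binomials H :
  (forall u v : 'X_{1..#|edges H|},
     edges_mnm (mnm_edges u) = edges_mnm (mnm_edges v) ->
     quadric_ideal ('X_[u] - 'X_[v])) ->
  forall f, toric_ideal K H f -> quadric_ideal f.
Proof.
move=> bin f; rewrite /toric_ideal /= => f0.
pose phi (u : 'X_{1..#|edges H|}) := edges_mnm (mnm_edges u).
(* The first support monomial in the fibre over [w]; the default is reached only for fibres that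
   miss the support. *)
pose rep w := nth 0%MM (msupp f) (find (fun v => phi v == w) (msupp f)).
have repP u : u \in msupp f -> phi (rep (phi u)) = phi u.
  move=> uf; apply/eqP; rewrite /rep.
  apply: (nth_find _ (a := fun v => phi v == phi u)).
  by apply/hasP; exists u.
have phiE u : toric_map 'X_[u] = 'X_[K, phi u].
  by rewrite -edges_mon_mnm_edges toric_map_edges_mon ?mnm_edges_all.
pose g := \sum_(u <- msupp f) f@_u *: 'X_[K, rep (phi u)].
have g0 : g = 0.
  apply/mpolyP => m; rewrite mcoeff0 /g raddf_sum /=.
  (* A monomial that represents its own fibre collects the coefficients of [f] over that fibre,
     which add up to one coefficient of [toric_map f]; any other monomial gets 0. *)
  transitivity ((rep (phi m) == m)%:R * (toric_map f)@_(phi m)); last first.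
    by rewrite f0 mcoeff0 mulr0.
  rewrite [X in toric_map X]mpolyE rmorph_sum raddf_sum /= mulr_sumr.
  apply: eq_big_seq => u uf.
  rewrite mcoeffZ mcoeffX -mul_mpolyC rmorphM /= phiE.
  rewrite /toric_map mmapC mcoeffCM mcoeffX mulrCA.
  congr (_ * _); rewrite -natrM mulnb; congr (nat_of_bool _)%:R.
  apply/idP/idP => [/eqP mE|/andP[/eqP mE /eqP ->]]; last by rewrite mE.
  by rewrite -mE repP // mE !eqxx.
have fE : f = \sum_(u <- msupp f) f@_u *: ('X_[u] - 'X_[rep (phi u)]).
  under eq_bigr do rewrite scalerBr.
  by rewrite sumrB -mpolyE -/g g0 subr0.
rewrite [X in quadric_ideal X]fE.
apply: ideal_gen_sum => u uf; rewrite -mul_mpolyC.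
by apply/ideal_genM/bin; rewrite [RHS]repP.
Qed.

Lemma quadratic_graphI H :
  (forall s t, all (edges_of H) s -> all (edges_of H) t ->
     edges_mnm s = edges_mnm t ->
     quadric_ideal (edges_mon H s - edges_mon H t)) ->
  quadratic_graph K H.
Proof.
move=> bin.
exists [set f | quadratic_binomial f /\ toric_ideal K H f]%classic.
split=> [f []|] //; apply/seteqP; split; last exact: quadric_ideal_toric.
apply: toric_ideal_binomials => u v uv.
by rewrite -!edges_mon_mnm_edges; apply: bin => //; apply: mnm_edges_all.
Qed.

(** * Transfer of congruences from a subgraph *)

Section Subgraph.
Variables (H G : sgraph d).
Hypothesis subHG : subrel H G.

(** Edges are numbered separately in [H] and [G], so each variable is sent to the variable of the
    same edge in [G]. *)
Let incl : {rmorphism {mpoly K[#|edges H|]} -> {mpoly K[#|edges G|]}} :=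
  mmap (@mpolyC _ K) (fun k => edge_var G (enum_val k)).

Let incl_edges_mon s :
  all (edges_of H) s -> incl (edges_mon H s) = edges_mon G s.
Proof.
move=> /allP sH; rewrite /edges_mon rmorph_prod.
apply: eq_big_seq => p /sH/edge_var_edge[k -> kE].
rewrite /incl /= mmapX mmap1U; case: kE => -> //.
by case: (p) => i j; rewrite edge_varC.
Qed.

(** The binomial is a combination of quadratic generators over [H]. Each generator is a difference
    of two products of two edges with equal toric image, so [quadric_exchange] handles its image
    under [incl]. *)
Lemma quadratic_subgraph s t : quadratic_graph K H ->
  all (edges_of H) s -> all (edges_of H) t -> edges_mnm s = edges_mnm t ->
  quadric_ideal (edges_mon G s - edges_mon G t).
Proof.
case=> B [Bq BE] sH tH st.
have : toric_ideal K H (edges_mon H s - edges_mon H t).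
  by rewrite /toric_ideal /= rmorphB /= !toric_map_edges_mon // st subrr.
rewrite BE => -[n [c [g [Bg gE]]]].
rewrite -!incl_edges_mon // -rmorphB gE rmorph_sum.
apply: ideal_gen_sum => i _; rewrite rmorphM; apply: ideal_genM.
have [u [v [u2 v2 _ giE]]] := Bq _ (Bg i).
have : toric_ideal K H (g i) by rewrite BE; apply: ideal_gen_sub.
rewrite giE /toric_ideal /= -!edges_mon_mnm_edges !rmorphB /=.
rewrite !incl_edges_mon ?mnm_edges_all //.
rewrite !toric_map_edges_mon ?mnm_edges_all // => /eqP.
rewrite subr_eq0 => /eqP/mpolyX_inj.
have /allP := mnm_edges_all u; have /allP := mnm_edges_all v.
have := size_mnm_edges u; have := size_mnm_edges v; rewrite u2 v2.
case: (mnm_edges u) => [|p1 [|p2 []]] //;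
  case: (mnm_edges v) => [|q1 [|q2 []]] //.
move=> _ _ Hq Hp; apply: quadric_exchange.
apply/allP => p; rewrite !inE => pE; apply: subHG.
by case/or4P: pE => /eqP ->; (apply: Hp + apply: Hq); rewrite !inE eqxx ?orbT.
Qed.

End Subgraph.

End ToricIdeal.

(** * Moving monomials to one side of the hyperplane *)

Section Separation.
Variables (R : realType) (K : fieldType) (d : nat) (G : sgraph d).
Variables (a : 'rV[R]_d) (b : R).
Hypothesis int_pos :
  integral_polytope (edge_polytope R G `&` halfspace_pos a b)%classic.
Implicit Types s t : seq ('I_d * 'I_d).

Local Notation lev := (level a b).

(** Regrouped by vertices, the sum depends only on the exponent and the length of the list, and
    [mdeg_edges_mnm] recovers the length from the exponent. *)
Lemma sum_level s : \sum_(p <- s) lev p =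
  \sum_(i < d) a 0 i * (edges_mnm s i)%:R - b * (size s)%:R.
Proof.
elim: s => [|p s IHs].
  rewrite big_nil mulr0 subr0 big1 // => i _.
  by rewrite /edges_mnm big_nil mnm0E mulr0.
rewrite big_cons IHs /edges_mnm big_cons -/(edges_mnm s) /=.
under [in RHS]eq_bigr do rewrite !mnmDE !mnm1E !natrD !mulrDr.
rewrite !big_split /=.
have sum_delta j : \sum_(i < d) a 0 i * (j == i)%:R = a 0 j.
  rewrite (bigD1 j) //= eqxx mulr1 big1 ?addr0 // => i /negbTE.
  by rewrite eq_sym => ->; rewrite mulr0.
by rewrite !sum_delta /level -natr1; ring.
Qed.

Lemma mdeg_edges_mnm s : mdeg (edges_mnm s) = (size s).*2.
Proof.
elim: s => [|p s IHs]; first by rewrite /edges_mnm big_nil mdeg0.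
rewrite /edges_mnm big_cons -/(edges_mnm s) /edge_mnm.
by rewrite !mdegD !mdeg1 IHs.
Qed.

Lemma sum_level_eq s t : edges_mnm s = edges_mnm t ->
  \sum_(p <- s) lev p = \sum_(p <- t) lev p.
Proof.
move=> st; rewrite !sum_level st.
by have /(congr1 half) := mdeg_edges_mnm s;
  rewrite st mdeg_edges_mnm !doubleK => ->.
Qed.

Lemma edges_mon_perm s t :
  perm_eq s t -> edges_mon K G s = edges_mon K G t.
Proof. exact: perm_big. Qed.

Lemma edges_mnm_perm s t : perm_eq s t -> edges_mnm s = edges_mnm t.
Proof. exact: perm_big. Qed.

(* Exchanging a crossing pair for two edges in the hyperplane lowers the number
   of edges off the hyperplane. *)
Lemma one_sided_representative s : all (edges_of G) s ->
  exists t, [/\ all (edges_of G) t, edges_mnm t = edges_mnm s,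
    quadric_ideal (edges_mon K G s - edges_mon K G t)
    & all (fun p => 0 <= lev p) t \/ all (fun p => lev p <= 0) t].
Proof.
have [n] := ubnP (count (fun p => lev p != 0) s).
elim: n s => // n IHn s ltn sG.
have [pos|/allPn[e es]] := boolP (all (fun p => 0 <= lev p) s).
  by exists s; split; rewrite ?subrr //; [exact: ideal_gen0|left].
have [neg _|/allPn[f fs]] := boolP (all (fun p => lev p <= 0) s).
  by exists s; split; rewrite ?subrr //; [exact: ideal_gen0|right].
rewrite -!ltNge => f0 e0.
have nfe : f != e by apply: contraTneq f0 => ->; rewrite -leNgt ltW.
pose s0 := rem e (rem f s).
have sE : perm_eq s [:: f, e & s0].
  apply: perm_trans (perm_to_rem fs) _; rewrite perm_cons perm_to_rem //.
  by move: es; rewrite (perm_mem (perm_to_rem fs)) inE eq_sym (negbTE nfe).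
move: sG ltn; rewrite (perm_all _ sE) (permP sE) /= => /and3P[Gf Ge Gs0].
rewrite (gt_eqF f0) (lt_eqF e0) /= !add1n => ltn.
have opp : lev f * lev e < 0 by rewrite pmulr_rlt0.
have [k' [l' [kl Gik Gjl lik ljl]]] :=
  crossing_edges_exchange int_pos Gf Ge opp.
pose s1 := [:: (f.1, k'), (f.2, l') & s0].
have s1s : edges_mnm [:: f; e] = edges_mnm [:: (f.1, k'); (f.2, l')].
  rewrite /edges_mnm !big_cons big_nil /edge_mnm /=.
  by case: kl => -[-> ->]; apply/mnmP => x; rewrite !mnmDE; ring.
have [||t [tG tE st tsgn]] := IHn s1.
(* The count drops by two where the induction asks for one, hence [ltnW]. *)
- by rewrite /= lik ljl eqxx /= !add0n; apply: ltnW.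
- by rewrite /= /edges_of /= Gik Gjl.
exists t; split=> //.
  rewrite tE (edges_mnm_perm sE); move: s1s.
  by rewrite /edges_mnm !big_cons big_nil !addm0 !addmA => ->.
apply: ideal_gen_trans st.
have := quadric_exchange K (H := G) _ s1s.
rewrite !edges_mon_cons {1 2}/edges_mon !big_nil !mulr1 => exch.
(* The untouched edges [s0] factor out, leaving a multiple of the exchange binomial. *)
rewrite (edges_mon_perm sE) /s1 !edges_mon_cons !mulrA -mulrBl mulrC.
apply/ideal_genM/exch => /=.
by rewrite Gf Ge /edges_of /= Gik Gjl.
Qed.

End Separation.

Theorem theorem4p3 (R : realType) (K : fieldType) (d : nat) (G : sgraph d)
    (a : 'rV[R]_d) (b : R) :
  connected_graph G ->
  separating_hyperplane (edge_polytope R G) a b ->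
  quadratic_graph K (graph_pos G a b) ->
  quadratic_graph K (graph_neg G a b) ->
  quadratic_graph K G.
Proof.
move=> _ [_ _ _ int_pos _] quad_pos quad_neg.
apply: quadratic_graphI => s t sG tG st.
have [s' [s'G s'E ss' s'sgn]] := one_sided_representative K int_pos sG.
have [t' [t'G t'E tt' t'sgn]] := one_sided_representative K int_pos tG.
apply: ideal_gen_trans ss' _; apply: ideal_gen_trans (ideal_gen_distC tt').
have st' : edges_mnm s' = edges_mnm t' by rewrite s'E t'E.
have sum_st := sum_level_eq a b st'.
set lev := level a b in s'sgn t'sgn sum_st.
have pos u : all (edges_of G) u -> all (fun p => 0 <= lev p) u ->
    all (edges_of (graph_pos G a b)) u.
  move=> /allP uG /allP u0; apply/allP => p pu.
  apply/andP; split; first exact: uG.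
  rewrite dotv_edge_vec -subr_ge0.
  exact: u0.
have neg u : all (edges_of G) u -> all (fun p => lev p <= 0) u ->
    all (edges_of (graph_neg G a b)) u.
  move=> /allP uG /allP u0; apply/allP => p pu.
  apply/andP; split; first exact: uG.
  rewrite dotv_edge_vec -subr_le0.
  exact: u0.
(* Nonpositive levels with a nonnegative sum all vanish, so such a list lies in the hyperplane and
   counts for either side. *)
have flat u : all (fun p => lev p <= 0) u ->
    0 <= \sum_(p <- u) lev p -> all (fun p => 0 <= lev p) u.
  elim: u => //= p u IHu /andP[p0 u0]; rewrite big_cons => sum0.
  have : \sum_(q <- u) lev q <= 0.
    by rewrite big_seq; apply: sumr_le0 => q qu; apply: (allP u0).
  by move=> ?; rewrite IHu ?andbT //; lra.
have all_pos : all (fun p => 0 <= lev p) s' ->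
    all (fun p => 0 <= lev p) t' ->
    quadric_ideal (edges_mon K G s' - edges_mon K G t').
  move=> s'0 t'0; apply: quadratic_subgraph quad_pos _ _ st'; try exact: pos.
  by move=> i j /andP[].
have sum_ge0 u : all (fun p => 0 <= lev p) u -> 0 <= \sum_(p <- u) lev p.
  by move=> /allP u0; rewrite big_seq; apply: sumr_ge0.
(* When the signs differ, the common total level forces the nonpositive list into the hyperplane,
   and both lists live on the positive side. *)
case: s'sgn t'sgn => [s'0|s'0] [t'0|t'0].
- exact: all_pos.
- by apply: all_pos => //; apply: flat => //; rewrite -sum_st sum_ge0.
- by apply: all_pos => //; apply: flat => //; rewrite sum_st sum_ge0.
- apply: quadratic_subgraph quad_neg _ _ st'; try exact: neg.
  by move=> i j /andP[].
Qed.
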